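(* Let $(W,S)$ be a finite Coxeter system and let $I\subseteq S$. Then one has isomorphisms (respectively, an equality) of $\mathcal H_W(0)$-modules $$\theta(\mathcal P_I^S)\cong\mathcal P_{I^c}^S\cong\theta[\mathcal P_I^S]\qquad\text{and}\qquad\phi(\mathcal P_I^S)=\mathcal P_{\sigma(I)}^S\cong\phi[\mathcal P_I^S].$$
   Context: $\mathbb F$ is an arbitrary field. $(W,S)$ is a finite Coxeter system with relations $s^2=1$, $(sts\cdots)_{m_{st}}=(tst\cdots)_{m_{st}}$; $w_0$ is the longest element of $W$; for $I\subseteq S$, $I^c=S\setminus I$ and $w_0(I)$ is the longest element of the parabolic subgroup generated by $I$. $\sigma:S\to S$, $\sigma(s)=w_0sw_0$, is the automorphism of the Coxeter diagram induced by conjugation by $w_0$. The 0-Hecke algebra $\mathcal H_W(0)$ is the $\mathbb F$-algebra generated by $\{\pi_s:s\in S\}$ with $\pi_s^2=\pi_s$ and $(\pi_s\pi_t\pi_s\cdots)_{m_{st}}=(\pi_t\pi_s\pi_t\cdots)_{m_{st}}$. $\overline\pi_s:=\pi_s-1$. For a reduced expression $w=s_1\cdots s_k$, $\pi_w=\pi_{s_1}\cdots\pi_{s_k}$ and $\overline\pi_w=\overline\pi_{s_1}\cdots\overline\pi_{s_k}$. $\mathcal P_I^S:=\mathcal H_W(0)\,\overline\pi_{w_0(I)}\pi_{w_0(I^c)}$ (a left ideal). $\theta$ and $\phi$ are the algebra automorphisms of $\mathcal H_W(0)$ with $\theta(\pi_s)=-\overline\pi_s=1-\pi_s$ and $\phi(\pi_s)=\pi_{w_0sw_0}=\pi_{\sigma(s)}$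 for all $s\in S$ (commuting involutions). For an $\mathcal H_W(0)$-module $M$, $\theta[M]$ (resp. $\phi[M]$) is the same vector space with $\pi_s$ acting as $\theta(\pi_s)$ (resp. $\phi(\pi_s)$) acts on $M$. If $M$ is a submodule (left ideal) of $\mathcal H_W(0)$, then $\theta(M)$ (resp. $\phi(M)$) is the image of $M$ under $\theta$ (resp. $\phi$), again a left ideal. *)

(* Defs.v *)
From HB Require Import structures.
From mathcomp Require Import all_boot all_order all_fingroup all_algebra.
From mathcomp Require Import boolp classical_sets.

Set Implicit Arguments.
Unset Strict Implicit.
Unset Printing Implicit Defensive.

Import GRing.Theory.
Local Open Scope ring_scope.

(* The word s t s t ... with n letters. *)
Fixpoint altw (T : Type) (s t : T) (n : nat) : seq T :=
  if n is n'.+1 then s :: altw t s n' else [::].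

Section Coxeter.
Variables (W : finGroupType) (S : {set W}).

(* Only the values of m on S matter.  m s t = 0 stands for m_st = infinity:
   the braid relation of length 0 below is then trivially true. *)
Definition coxeter_matrix (m : W -> W -> nat) : Prop :=
  {in S &, forall s t, m s t = m t s /\ (m s t == 1%N) = (s == t)}.

Definition coxeter_relations (m : W -> W -> nat) (G : groupType) (f : W -> G)
    : Prop :=
  {in S, forall s, (f s * f s)%g = 1%g} /\
  {in S &, forall s t, s != t ->
     (\prod_(x <- altw s t (m s t)) f x)%g
       = (\prod_(x <- altw t s (m s t)) f x)%g}.

(* W is presented by the generators S and the Coxeter relations: it is
   generated by S, satisfies the relations, and is universal for them. *)
Record coxeter_system (m : W -> W -> nat) : Prop := CoxeterSystem {
  cox_matrix : coxeter_matrix m;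
  cox_gen : <<S>>%g = [set: W]%g;
  cox_rel : coxeter_relations m (fun x : W => x);
  cox_univ : forall (G : groupType) (f : W -> G), coxeter_relations m f ->
    exists2 h : W -> G, {morph h : x y / (x * y)%g} & {in S, h =1 f}
}.

Definition word_for (w : W) (u : seq W) : Prop :=
  all [in S] u /\ (\prod_(x <- u) x)%g = w.

Definition reduced_expr (w : W) (u : seq W) : Prop :=
  word_for w u /\ forall v, word_for w v -> (size u <= size v)%N.

(* A chosen reduced expression; one exists for every w in <<S>>. *)
Definition reduced_word (w : W) : seq W := xget [::] [set u | reduced_expr w u].

Definition cox_length (w : W) : nat := size (reduced_word w).

(* The longest element w_0(I) of the parabolic subgroup <<I>>. *)
Definition longest (I : {set W}) : W :=
  [arg max_(w > 1%g in <<I>>%g) cox_length w]%N.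

Definition sigma (s : W) : W := (longest S * s * longest S)%g.

End Coxeter.

Section ZeroHecke.
Variables (F : fieldType) (W : finGroupType) (S : {set W}) (m : W -> W -> nat).

Definition zero_hecke_relations (A : algType F) (a : W -> A) : Prop :=
  {in S, forall s, a s * a s = a s} /\
  {in S &, forall s t, s != t ->
     \prod_(x <- altw s t (m s t)) a x = \prod_(x <- altw t s (m s t)) a x}.

(* H is the F-algebra presented by the generators pi s, for s in S, and the
   relations of H_W(0); the values of pi outside S are irrelevant. *)
Record zero_hecke_algebra (H : algType F) (pi : W -> H) : Prop :=
  ZeroHeckeAlgebra {
  hecke_rel : zero_hecke_relations pi;
  hecke_univ : forall (A : algType F) (a : W -> A), zero_hecke_relations a ->
    exists f : {lrmorphism H -> A}, {in S, forall s, f (pi s) = a s};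
  hecke_uniq : forall (A : algType F) (f g : {lrmorphism H -> A}),
    {in S, forall s, f (pi s) = g (pi s)} -> f =1 g
}.

Variables (H : algType F) (pi : W -> H).

Definition hpi (w : W) : H := \prod_(s <- reduced_word S w) pi s.
Definition hpibar (w : W) : H := \prod_(s <- reduced_word S w) (pi s - 1).

End ZeroHecke.

(* Left ideals of R are the submodules of the regular left module R^o. *)
Notation leftIdeal R := (submodClosed R^o).

Section PrincipalIdeal.
Variables (R : nzRingType) (g : R).

Definition principal_ideal : {pred R^o} :=
  fun x => `[< exists h : R, x = h * g >].

Lemma principal_ideal_closed : submod_closed principal_ideal.
Proof.
split=> [|a x y /asboolP[h ->] /asboolP[k ->]]; apply/asboolP.
  by exists 0; rewrite mul0r.
by exists (a * h + k); rewrite mulrDl -mulrA.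
Qed.

HB.instance Definition _ :=
  GRing.isSubmodClosed.Build R R^o principal_ideal principal_ideal_closed.

End PrincipalIdeal.

Record algAut (F : fieldType) (A : algType F) := AlgAut {
  algAut_fun :> {lrmorphism A -> A};
  algAut_bij : bijective algAut_fun
}.

Section ImageIdeal.
Variables (F : fieldType) (A : algType F) (f : algAut A) (J : leftIdeal A).

Definition image_ideal : {pred A^o} :=
  fun y => `[< exists2 x : A, x \in J & y = f x >].

Lemma image_ideal_closed : submod_closed image_ideal.
Proof.
have [g _ gK] := algAut_bij f; have [J0 Jlin] := submodClosedP J.
split=> [|a x y /asboolP[h Jh ->] /asboolP[k Jk ->]]; apply/asboolP.
  by exists 0; rewrite ?rmorph0.
exists (g a * h + k); first exact: Jlin.
by rewrite rmorphD /= (rmorphM f (g a) h) /= gK.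
Qed.

HB.instance Definition _ :=
  GRing.isSubmodClosed.Build A A^o image_ideal image_ideal_closed.

End ImageIdeal.

Section IdealModule.
Variables (R : nzRingType) (J : leftIdeal R).

(* The left ideal J as an R-module in its own right. *)
Record ideal_module := IdealModule {
  ideal_val : R^o;
  ideal_valP : ideal_val \in J
}.

HB.instance Definition _ := [isSub for ideal_val].
HB.instance Definition _ := [Choice of ideal_module by <:].
HB.instance Definition _ := [SubChoice_isSubLmodule of ideal_module by <:].

End IdealModule.

(* f[M]: the abelian group M on which x acts as f x acts on M. *)
Definition twist (F : fieldType) (A : algType F) (f : algAut A)
  (M : lmodType A) : Type := M.

Section Twist.
Variables (F : fieldType) (A : algType F) (f : algAut A) (M : lmodType A).

HB.instance Definition _ := GRing.Zmodule.on (twist f M).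

Definition twist_scale (x : A) (v : twist f M) : twist f M :=
  f x *: (v : M).

Lemma twist_scaleA a b v :
  twist_scale a (twist_scale b v) = twist_scale (a * b) v.
Proof. by rewrite /twist_scale scalerA rmorphM. Qed.

Lemma twist_scale1 : left_id 1 twist_scale.
Proof. by move=> v; rewrite /twist_scale rmorph1 scale1r. Qed.

Lemma twist_scaleDr : right_distributive twist_scale +%R.
Proof. by move=> a u v; rewrite /twist_scale scalerDr. Qed.

Lemma twist_scaleDl v : {morph twist_scale^~ v : a b / a + b}.
Proof. by move=> a b; rewrite /twist_scale rmorphD scalerDl. Qed.

HB.instance Definition _ := GRing.Zmodule_isLmodule.Build A (twist f M)
  twist_scaleA twist_scale1 twist_scaleDr twist_scaleDl.

End Twist.

Definition mod_iso (R : nzRingType) (M N : lmodType R) : Prop :=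
  exists f : {linear M -> N}, bijective f.

Definition hecke_P (F : fieldType) (W : finGroupType) (S : {set W})
    (H : algType F) (pi : W -> H) (I : {set W}) : leftIdeal H :=
  principal_ideal (hpibar S pi (longest S I) * hpi S pi (longest S (S :\: I))).

(* Main.v *)
(* Write [p w] and [q w] for the products of the [pi s] and of the [1 - pi s]
   along a reduced word of [w], and let [a = p (w_0 I)], [b = q (w_0 I^c)].  Up to
   signs, which do not change the ideals, [theta] exchanges [p] and [q], so that
   [theta (P_I) = H a b] while [P_{I^c} = H b a]; right multiplication by [a] maps
   the former to the latter.  It is bijective because right multiplication by
   [a b] is unitriangular on [H a b] for the length filtration: [p w * b] is zero
   if [w] has a right descent in [I^c] and is otherwise [p w] plus longer terms,
   and likewise for [b a] with [p] and [q] exchanged.  Since [sigma] preserves [S]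
   and lengths, [phi] maps [p w], [q w] to [p (sigma w)], [q (sigma w)].

   Only the presentation of [W] is available, so the independence of [p w] of the
   reduced word (Matsumoto's theorem) is derived from two actions of [W] supplied
   by its universal property: one on [W * bool], which yields the exchange
   condition, and the geometric representation, which shows that the order of
   [s t] is exactly [m s t]. *)

Require Import Defs.
From HB Require Import structures.
From mathcomp Require Import all_boot all_order all_fingroup all_algebra all_field.
From mathcomp Require Import ring.
From mathcomp Require Import boolp classical_sets.

Set Implicit Arguments.
Unset Strict Implicit.
Unset Printing Implicit Defensive.

Import GRing.Theory.
Local Open Scope ring_scope.

(** * Braid relations as powers of a product of two involutions *)

Section AlternatingProducts.
Variables (T : Type) (G : groupType) (f : T -> G) (s t : T).
Hypotheses (fs : (f s * f s)%g = 1%g) (ft : (f t * f t)%g = 1%g).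

(** Inverting a word in involutions reverses it, so the quotient is an alternating word with [2 n]
    letters. *)
Lemma altw_expg n :
  ((\prod_(x <- altw s t n) f x) * (\prod_(x <- altw t s n) f x)^-1)%g
    = ((f s * f t) ^+ n)%g.
Proof.
have Vs : ((f s)^-1 = f s)%g by apply: (@mulIg _ (f s)); rewrite mulVg.
have Vt : ((f t)^-1 = f t)%g by apply: (@mulIg _ (f t)); rewrite mulVg.
elim: n => [|n IHn]; first by rewrite !big_nil invg1 mulg1.
have swapX k : (f s * (f t * f s) ^+ k * f t = (f s * f t) ^+ k.+1)%g.
  by elim: k => [|k IHk]; rewrite ?mulg1 // expgS [RHS]expgS -IHk !mulgA.
rewrite /= !big_cons invgM Vt -swapX -!mulgA; congr (_ * _)%g.
rewrite [LHS]mulgA; congr (_ * _)%g.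
by rewrite -{1}[(\prod_(x <- altw t s n) f x)%g]invgK -invgM IHn -expVgn invgM Vs Vt.
Qed.

Lemma altw_prodP n :
  (\prod_(x <- altw s t n) f x)%g = (\prod_(x <- altw t s n) f x)%g
    <-> ((f s * f t) ^+ n)%g = 1%g.
Proof.
rewrite -altw_expg; split=> [->|e]; first by rewrite mulgV.
by apply: (@mulIg _ (\prod_(x <- altw t s n) f x)^-1)%g; rewrite e mulgV.
Qed.

End AlternatingProducts.

(** * The group of bijections of an arbitrary type *)

Section SelfBijections.
Variable T : Type.

(** This group is a target for the universal property of [W] when the space acted on is infinite;
    the inverse is part of the data, so that the group operations are explicit. *)
Record selfbij := Selfbij {
  fwd :> T -> T; bwd : T -> T; fwdK : cancel fwd bwd; bwdK : cancel bwd fwd }.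

HB.instance Definition _ := gen_eqMixin selfbij.
HB.instance Definition _ := gen_choiceMixin selfbij.

Lemma selfbijP (f g : selfbij) : fwd f =1 fwd g -> f = g.
Proof.
case: f g => [f f' fK f'K] [g g' gK g'K] /= /funext fg; subst g.
have e : f' = g' by apply/funext => x; rewrite -[x in f' x]g'K fK.
by subst g'; congr Selfbij; apply: Prop_irrelevance.
Qed.

Definition selfbij1 : selfbij := Selfbij (frefl id) (frefl id).
Definition selfbijV (f : selfbij) : selfbij := Selfbij (@bwdK f) (@fwdK f).
Definition selfbijM (f g : selfbij) : selfbij :=
  Selfbij (can_comp (@fwdK f) (@fwdK g)) (can_comp (@bwdK g) (@bwdK f)).

Fact selfbijA : associative selfbijM. Proof. by move=> f g h; apply: selfbijP. Qed.
Fact selfbij1M : left_id selfbij1 selfbijM. Proof. by move=> f; apply: selfbijP. Qed.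
Fact selfbijM1 : right_id selfbij1 selfbijM. Proof. by move=> f; apply: selfbijP. Qed.
Fact selfbijVM : left_inverse selfbij1 selfbijV selfbijM.
Proof. by move=> f; apply: selfbijP => x; rewrite /= fwdK. Qed.
Fact selfbijMV : right_inverse selfbij1 selfbijV selfbijM.
Proof. by move=> f; apply: selfbijP => x; rewrite /= bwdK. Qed.

HB.instance Definition _ :=
  isGroup.Build selfbij selfbijA selfbij1M selfbijM1 selfbijVM selfbijMV.

Lemma selfbijME (f g : selfbij) x : (f * g)%g x = f (g x).
Proof. by []. Qed.

Lemma selfbijXE (f : selfbij) n x : (f ^+ n)%g x = iter n f x.
Proof. by elim: n x => //= n IHn x; rewrite expgS selfbijME IHn. Qed.

End SelfBijections.

(** * The order of a product of two generators *)

Section GeometricRepresentation.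
Variables (W : eqType) (K : fieldType) (c : W -> W -> K).
Hypothesis c_diag : forall s, c s s = - 2.

(** The contragredient geometric representation: [v t] is the value of a linear form at the simple
    root of [t], and [c s t] is [-2] times the bilinear form on two simple roots. *)
Definition reflection (s : W) (v : W -> K) : W -> K := fun t => v t + c s t * v s.

Lemma reflectionK s : involutive (reflection s).
Proof. by move=> v; apply/funext => t; rewrite /reflection c_diag; ring. Qed.

Definition reflection_bij s : selfbij (W -> K) :=
  Selfbij (reflectionK s) (reflectionK s).

Variables s t : W.

Let rot v := reflection s (reflection t v).

(** The functional [eta * v t + v s] is multiplied by [eta ^+ 2] under [rot]. The hypotheses are
    symmetric in [eta] and [eta^-1], which yields a second such functional. *)
Lemma rot_eigen eta n v : eta != 0 ->
  c s t = eta + eta^-1 -> c t s = eta + eta^-1 ->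
  eta * iter n rot v t + iter n rot v s = eta ^+ n.*2 * (eta * v t + v s).
Proof.
move=> eta0 c_st c_ts; elim: n => [|n IHn]; first by rewrite expr0 mul1r.
rewrite doubleS !exprS -!mulrA -IHn /= /rot /reflection c_st c_ts !c_diag.
by field.
Qed.

(** The degenerate case [eta = 1], for [m s t = 0]: [v t + v s] is invariant and [v t] grows
    linearly. *)
Lemma rot_unipotent n v : c s t = 2 -> c t s = 2 ->
  iter n rot v t = v t + n.*2%:R * (v t + v s).
Proof.
move=> c_st c_ts; elim: n => [|n IHn]; first by rewrite mul0r addr0.
have := @rot_eigen 1 n v; rewrite expr1n !mul1r invr1 => e.
transitivity (iter n rot v t + 2 * (iter n rot v t + iter n rot v s)).
  by rewrite /= {1}/rot /reflection c_st c_ts !c_diag; ring.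
by rewrite e ?oner_eq0 // IHn doubleS -addn2 natrD; ring.
Qed.

(* The plane of coordinates [s], [t] is diagonalised with eigenvalues
   [eta ^+ 2] and [eta ^- 2]; since the form is nondegenerate on it, any other
   coordinate can be corrected to an invariant one. *)
Lemma rot_eq_id eta n v : eta != 0 -> eta ^+ 2 != 1 ->
  c s t = eta + eta^-1 -> c t s = eta + eta^-1 ->
  eta ^+ n.*2 = 1 -> iter n rot v =1 v.
Proof.
move=> eta0 etaV c_st c_ts eta1.
have d0 : eta ^+ 2 - 1 != 0 by rewrite subr_eq0.
have e1 := rot_eigen n v eta0 c_st c_ts; rewrite eta1 mul1r in e1.
have := @rot_eigen eta^-1 n v; rewrite invr_eq0 invrK exprVn eta1 invr1 mul1r.
rewrite ![_^-1 + eta]addrC => /(_ eta0 c_st c_ts) e2.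
have et : iter n rot v t = v t.
  have d1 : (eta ^+ 2 - 1) / eta != 0 by rewrite mulf_neq0 ?invr_eq0.
  apply: (mulfI d1); transitivity (eta * iter n rot v t + iter n rot v s
     - (eta^-1 * iter n rot v t + iter n rot v s)); first by field.
  by rewrite e1 e2; field.
have es : iter n rot v s = v s by move: e1; rewrite et => /addrI.
(* [D] is the determinant of twice the form on the plane of [s] and [t]; Cramer's rule gives the
   coefficients of the invariant [M]. *)
move=> u; set D := 4 - (eta + eta^-1) ^+ 2.
have D0 : D != 0.
  have -> : D = - ((eta ^+ 2 - 1) / eta) ^+ 2 by rewrite /D; field.
  by rewrite oppr_eq0 expf_neq0 // mulf_neq0 ?invr_eq0.
pose M w := D * w u + (2 * c s u + (eta + eta^-1) * c t u) * w s
              + (2 * c t u + (eta + eta^-1) * c s u) * w t.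
have Ms w : M (reflection s w) = M w.
  by rewrite /M /reflection c_st !c_diag /D; ring.
have Mt w : M (reflection t w) = M w.
  by rewrite /M /reflection c_ts !c_diag /D; ring.
have : M (iter n rot v) = M v.
  by elim: n {e1 e2 et es eta1} => //= n IHn; rewrite /rot Ms Mt.
by rewrite /M et es => /addIr/addIr/(mulfI D0).
Qed.

End GeometricRepresentation.

Section CoxeterOrder.
Variables (W : finGroupType) (S : {set W}) (m : W -> W -> nat).
Hypothesis HW : coxeter_system S m.

Lemma cox_order s t n : s \in S -> t \in S -> s != t ->
  ((s * t) ^+ n)%g = 1%g -> (m s t %| n)%N.
Proof.
move=> sS tS nst st1.
(* A primitive root of order [2 m] plays the part of [exp (i pi / m)], so that [eta + eta^-1]
   replaces [2 cos (pi / m)]; the value [1] at [0] encodes an infinite [m]. *)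
have [eta eta_0 eta_prim] : exists2 eta : nat -> algC, eta 0 = 1
    & forall k, (0 < k)%N -> k.*2.-primitive_root (eta k).
  exists (fun k => if k is k'.+1 then sval (C_prim_root_exists (ltn0Sn k'.*2.+1)) else 1).
    by [].
  by case=> // k _; case: C_prim_root_exists.
pose c (x y : W) : algC := if x == y then - 2 else eta (m x y) + (eta (m x y))^-1.
have c_diag x : c x x = - 2 by rewrite /c eqxx.
have cE x y : x != y -> c x y = eta (m x y) + (eta (m x y))^-1.
  by rewrite /c => /negPf->.
have cC x y : x \in S -> y \in S -> x != y -> c y x = c x y.
  by move=> xS yS nxy; rewrite (cE _ _ nxy) cE 1?eq_sym // (cox_matrix HW xS yS).1.
have eta_neq0 k : eta k != 0.
  case: k => [|k]; first by rewrite eta_0 oner_eq0.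
  by have := eta_prim k.+1 isT; rewrite (prim_root_eq0 (eta_prim k.+1 isT)).
pose f := reflection_bij c_diag.
have fE x y k v : ((f x * f y) ^+ k)%g v =
    iter k (fun w => reflection c x (reflection c y w)) v by rewrite selfbijXE.
have f2 x : (f x * f x)%g = 1%g.
  by apply: selfbijP => v; apply: (reflectionK c_diag).
have [|h hM hf] := cox_univ HW (f := f).
  split=> // x y xS yS nxy; apply/altw_prodP => //.
  apply: selfbijP => v; rewrite fE; change (fwd 1%g v) with v; apply/funext.
  case m_xy: (m x y) => [//|k]; rewrite -m_xy.
  apply: (rot_eq_id c_diag v (eta_neq0 (m x y))).
  (* Here [eta ^+ 2 != 1] because [m x y] is not [1] for distinct [x] and [y]. *)
  - rewrite -(prim_order_dvd (eta_prim (m x y) _)) m_xy //.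
    case: k m_xy => // m_xy; have := (cox_matrix HW xS yS).2.
    by rewrite m_xy (negPf nxy).
  - exact: cE.
  - by rewrite cC // cE.
  by rewrite (prim_expr_order (eta_prim _ _)) // m_xy.
have hX k : h ((s * t) ^+ k)%g = ((f s * f t) ^+ k)%g.
  have h1 : h 1%g = 1%g by apply: (@mulgI _ (h 1%g)); rewrite -hM !mulg1.
  by elim: k => // k IHk; rewrite !expgS !hM IHk !hf.
(* On the indicator function of [s] the eigenfunctional takes the value [1], so that
   [eta ^+ n.*2 = 1]; if [m s t = 0], the linear growth forces [n = 0]. *)
pose v x : algC := (x == s)%:R.
have vs : v s = 1 by rewrite /v eqxx.
have vt : v t = 0 by rewrite /v eq_sym (negPf nst).
have rv : iter n (fun w => reflection c s (reflection c t w)) v = v.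
  by rewrite -fE -hX st1 -(expg0 (s * t)%g) hX.
have cts : c t s = eta (m s t) + (eta (m s t))^-1 by rewrite cC ?cE.
case m_st: (m s t) => [|k].
  have := rot_unipotent c_diag n v (_ : c s t = 2) (_ : c t s = 2).
  rewrite rv vs vt !add0r mulr1 cts cE // m_st eta_0 invr1 => /(_ erefl erefl).
  by move/eqP; rewrite eq_sym Num.Theory.pnatr_eq0 double_eq0 dvd0n.
have := rot_eigen c_diag n v (eta_neq0 (m s t)) (cE _ _ nst) cts.
rewrite rv vs vt mulr0 add0r mulr1 => /esym/eqP.
by rewrite m_st -(prim_order_dvd (eta_prim k.+1 isT)) -!muln2 dvdn_pmul2r.
Qed.

End CoxeterOrder.

(** * Length, exchange and longest elements *)

Section CoxeterGroup.
Variables (W : finGroupType) (S : {set W}) (m : W -> W -> nat).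
Hypothesis HW : coxeter_system S m.

Local Notation l := (cox_length S).

Lemma gen_mulV s : s \in S -> (s * s)%g = 1%g.
Proof. exact: (cox_rel HW).1. Qed.

Lemma gen_inv s : s \in S -> (s^-1)%g = s.
Proof. by move=> /gen_mulV ss; apply: (@mulIg _ s); rewrite mulVg ss. Qed.

Lemma gen_mulK s w : s \in S -> (s * (s * w))%g = w.
Proof. by move=> /gen_mulV ss; rewrite mulgA ss mul1g. Qed.

Lemma word_in_gen (J : {set W}) (u : seq W) :
  all [in J] u -> (\prod_(x <- u) x)%g \in <<J>>%g.
Proof.
move=> /allP uJ; rewrite big_seq; apply: group_prod => x /uJ xJ.
exact: mem_gen.
Qed.

Lemma gen_word (J : {set W}) w : J \subset S -> w \in <<J>>%g ->
  exists2 u, all [in J] u & (\prod_(x <- u) x)%g = w.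
Proof.
move=> sJS /gen_prodgP[n [c cJ ->]].
exists [seq c i | i <- index_enum 'I_n]; last by rewrite big_map.
by apply/allP => _ /mapP[i _ ->]; apply: cJ.
Qed.

Lemma word_forP w : exists u, word_for S w u.
Proof.
have [|u uS uw] := @gen_word S w (subxx S); last by exists u.
by rewrite (cox_gen HW) inE.
Qed.

Lemma reduced_wordP w : reduced_expr S w (reduced_word S w).
Proof.
rewrite /reduced_word; case: xgetP => [u -> //|]; have [u0 u0w] := word_forP w.
have ex : exists k, `[< exists2 u, word_for S w u & size u = k >].
  by exists (size u0); apply/asboolP; exists u0.
case: (ex_minnP ex) => k /asboolP[u uw <-] u_min /(_ u)[]; split=> // v vw.
by apply: u_min; apply/asboolP; exists v.
Qed.

Lemma cox_length_le w u : word_for S w u -> (l w <= size u)%N.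
Proof. exact: (reduced_wordP w).2. Qed.

Lemma reduced_size w u : reduced_expr S w u -> size u = l w.
Proof.
move=> [uw u_min]; apply/eqP; rewrite eqn_leq cox_length_le // andbT.
exact/u_min/(reduced_wordP w).1.
Qed.

Lemma reduced_exprP w u : word_for S w u -> (size u <= l w)%N ->
  reduced_expr S w u.
Proof. by move=> uw ul; split=> // v /cox_length_le; apply: leq_trans. Qed.

Lemma cox_length1 : l 1%g = 0%N.
Proof. by apply/eqP; rewrite -leqn0 (@cox_length_le _ [::]) //; split; rewrite ?big_nil. Qed.

Lemma cox_length_eq0 w : (l w == 0)%N = (w == 1%g).
Proof.
apply/eqP/eqP=> [|->]; last exact: cox_length1.
have [[_ ew] _] := reduced_wordP w.
by move=> /size0nil w0; rewrite -ew w0 big_nil.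
Qed.

Lemma word_for_rev w u : word_for S w u -> word_for S w^-1%g (rev u).
Proof.
move=> [uS <-]; split; first by rewrite all_rev.
elim: u uS => [|s u IHu] /=; first by rewrite big_nil invg1.
case/andP=> sS uS; rewrite rev_cons -cats1 big_cat big_seq1 big_cons invMg.
by rewrite IHu //= (gen_inv sS).
Qed.

Lemma cox_lengthV w : l w^-1%g = l w.
Proof.
suff le x : (l x^-1%g <= l x)%N by apply/eqP; rewrite eqn_leq le -{1}[w]invgK le.
have [/word_for_rev xr _] := reduced_wordP x.
by rewrite (leq_trans (cox_length_le xr)) // size_rev.
Qed.

Lemma word_for_cat v w u u' :
  word_for S v u -> word_for S w u' -> word_for S (v * w)%g (u ++ u').
Proof. by move=> [uS <-] [u'S <-]; split; rewrite ?all_cat ?uS // big_cat. Qed.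

Lemma word_for1 s : s \in S -> word_for S s [:: s].
Proof. by move=> sS; split; rewrite /= ?sS // big_seq1. Qed.

Lemma cox_lengthM v w : (l (v * w)%g <= l v + l w)%N.
Proof.
rewrite {2 3}/cox_length -size_cat; apply: cox_length_le.
exact: word_for_cat (reduced_wordP v).1 (reduced_wordP w).1.
Qed.

Lemma cox_length_gen s : s \in S -> (l s <= 1)%N.
Proof. by move=> /word_for1/cox_length_le. Qed.

(* [n w t] is the parity of the number of [i] such that [t] is the reflection
   [s_1 ... s_i ... s_1], for any word [s_1 ... s_k] of [w]. *)
Lemma reflection_cocycle : exists n : W -> W -> bool,
  (forall v w t, n (v * w)%g t = n v t (+) n w (t ^ v)%g) /\
  (forall s t, s \in S -> n s t = (t == s)).
Proof.
(* A generator [s] conjugates the first component and flips the sign exactly at [s]; [n w t] is the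
   sign that [w] gives to [(t, false)]. *)
pose f0 s (p : W * bool) := ((p.1 ^ s)%g, p.2 (+) (p.1 == s)).
have f0_inj s : injective (f0 s).
  by move=> [x a] [y b] [/conjg_inj<-]; rewrite /= => /addIb->.
pose f s := perm (@f0_inj s).
have f2 s : s \in S -> (f s * f s)%g = 1%g.
  move=> sS; apply/permP => -[x a]; rewrite permM !permE /f0 /= -conjgM gen_mulV //.
  rewrite conjg1 -addbA; congr (_, _); have {3}<- : (s ^ s = s)%g by rewrite conjgE mulKg.
  by rewrite (inj_eq (conjg_inj s)) addbb addbF.
have [|h hM hf] := cox_univ HW (f := f).
  split=> // s t sS tS nst; apply/altw_prodP; rewrite ?f2 //.
  have st1 : ((s * t) ^+ m s t)%g = 1%g.
    have := (cox_rel HW).2 s t sS tS nst.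
    by move/(altw_prodP (f := id)); apply; apply: gen_mulV.
  (* The flips made by the [k]-th power of [s t] occur at the reflections [(s t)^i s] with
     [i < 2 k]. Since [(s t)^k = 1], the second half repeats the first and the parities cancel. *)
  set k := m s t in st1 *; pose r i x := x == ((s * t) ^+ i * s)%g.
  have rst x a : (f s * f t)%g (x, a) = ((x ^ (s * t))%g, a (+) r 0%N x (+) r 1%N x).
    rewrite permM !permE /f0 /= conjgM /r expg0 mul1g expg1.
    have -> : ((x ^ s)%g == t) = (x == (s * t * s)%g); last by [].
    by rewrite -(inj_eq (conjg_inj s)) -conjgM gen_mulV // conjg1 conjgE gen_inv // !mulgA.
  have rJ i x : r i (x ^ (s * t))%g = r i.+2 x.
    rewrite /r -(inj_eq (conjg_inj (s * t)^-1%g)) conjgK; congr (_ == _).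
    rewrite conjgE invgK expgS expgSr [in LHS]invMg !gen_inv //.
    by rewrite !mulgA; congr (_ * _)%g; rewrite -!mulgA.
  have rP x a i : ((f s * f t) ^+ i)%g (x, a) =
      ((x ^ ((s * t) ^+ i))%g, a (+) \big[addb/false]_(j < i.*2) r j x).
    elim: i x a => [|i IHi] x a; first by rewrite perm1 conjg1 big_ord0 addbF.
    rewrite expgS permM rst IHi expgS -conjgM doubleS 2!big_ord_recl /= -!addbA.
    congr (_, a (+) (_ (+) (_ (+) _))); apply: eq_bigr => j _.
    by rewrite rJ.
  apply/permP => -[x a]; rewrite rP st1 perm1 conjg1 -addnn big_split_ord /=.
  rewrite [X in _ (+) X](_ : _ = false) ?addbF //.
  set A := \big[_/_]_(_ < _) _; rewrite [X in _ (+) X](_ : _ = A) ?addbb //.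
  by apply: eq_bigr => i _; rewrite /r expgnDr st1 mul1g.
have h1 : h 1%g = 1%g by apply: (@mulgI _ (h 1%g)); rewrite -hM !mulg1.
have hE w x a : h w (x, a) = ((x ^ w)%g, a (+) (h w (x, false)).2).
  have [u [uS <-]] := word_forP w.
  elim: u uS x a => [|s u IHu] /= => [_|/andP[sS uS]] x a.
    by rewrite big_nil h1 !perm1 conjg1 addbF.
  rewrite big_cons hM !permM (hf s sS) !permE /f0 /= IHu // [in RHS]IHu // conjgM.
  by rewrite /= addbA.
exists (fun w t => (h w (t, false)).2); split=> [v w t|s t sS].
  by rewrite hM permM (hE v) /= hE.
by rewrite hf // permE.
Qed.

(** * Strong exchange from the reflection cocycle *)

Section Cocycle.
Variable n : W -> W -> bool.
Hypothesis nM : forall v w t, n (v * w)%g t = n v t (+) n w (t ^ v)%g.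
Hypothesis n_gen : forall s t, s \in S -> n s t = (t == s).

(** The letter deleted is the first one whose reflection [s_1 ... s_i ... s_1] equals [t]; an odd
    count ensures that there is one. *)
Lemma cocycle_delete t w u : word_for S w u -> n w t ->
  exists u1 x u2, u = u1 ++ x :: u2 /\ (\prod_(y <- u1 ++ u2) y = t * w)%g.
Proof.
have n1 z : n 1%g z = false by have := nM 1 1 z; rewrite mulg1 conjg1 addbb.
case=> uS <-; elim: u uS t => [|s u IHu] /=; first by move=> _ t; rewrite big_nil n1.
case/andP=> sS uS t; rewrite big_cons nM n_gen //.
have [-> _|nts] := eqVneq t s.
  by exists [::], s, u; rewrite gen_mulK.
rewrite addFb => /(IHu uS)[u1 [x [u2 [-> e]]]].
by exists (s :: u1), x, u2; rewrite /= big_cons e conjgE gen_inv // !mulgA gen_mulV // mul1g.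
Qed.

Lemma cocycle_lt w t : n w t -> (l (t * w)%g < l w)%N.
Proof.
have [rw _] := reduced_wordP w.
move=> /(cocycle_delete rw)[u1 [x [u2 [eu ew]]]].
rewrite {2}/cox_length eu size_cat /= addnS ltnS -size_cat; apply: cox_length_le.
split=> //; move: rw.1; rewrite eu !all_cat /= => /and3P[-> _ ->].
by [].
Qed.

(** In [v^-1 * s * v] the contributions of [v^-1] and [v] cancel, because those of [v^-1 * v = 1]
    do; only [n s s] remains. *)
Lemma cocycle_reflection v s : s \in S -> n (s ^ v)%g (s ^ v)%g.
Proof.
move=> sS; have n1 : n (v^-1 * v)%g (s ^ v)%g = false.
  by rewrite mulVg; have := nM 1 1 (s ^ v)%g; rewrite mulg1 conjg1 addbb.
have -> : n (s ^ v)%g (s ^ v)%g = n v^-1%g (s ^ v)%g (+) (n s s (+) n v s).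
  by rewrite {1}conjgE !nM conjgK [(s ^ s)%g]conjgE mulKg.
by move: n1; rewrite nM conjgK (n_gen _ sS) eqxx; case: (n v^-1%g _); case: (n v s).
Qed.

(** For [t = s ^ v] the cocycle rule gives [n (t * w) t = n t t (+) n w t], which is true, so
    [cocycle_lt] applies to [t * w]. *)
Lemma cocycle_gt w v s : s \in S -> ~~ n w (s ^ v)%g -> (l w < l (s ^ v * w)%g)%N.
Proof.
move=> sS nw; have t2 : (s ^ v * s ^ v = 1)%g by rewrite -conjMg gen_mulV // conj1g.
rewrite -[in X in (X < _)%N](mul1g w) -t2 -mulgA.
apply: cocycle_lt; rewrite nM cocycle_reflection //.
by rewrite [((s ^ v) ^ _)%g]conjgE mulKg (negPf nw).
Qed.

End Cocycle.

Lemma cox_length_refl w v s : s \in S -> l (s ^ v * w)%g != l w.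
Proof.
move=> sS; have [n [nM n_gen]] := reflection_cocycle; rewrite neq_ltn.
case nw: (n w (s ^ v)%g); first by rewrite (cocycle_lt nM n_gen nw).
by rewrite (cocycle_gt nM n_gen sS) ?nw ?orbT.
Qed.

Lemma cox_lengthMl w s : s \in S -> (l w < l (s * w)%g)%N -> l (s * w)%g = (l w).+1.
Proof.
move=> sS lt; apply/eqP; rewrite eqn_leq lt andbT.
by rewrite (leq_trans (cox_lengthM s w)) // -add1n leq_add2r cox_length_gen.
Qed.

Lemma cox_length_ltnNge w s : s \in S ->
  (l (s * w)%g < l w)%N = ~~ (l w < l (s * w)%g)%N.
Proof.
move=> sS; rewrite -leqNgt ltn_neqAle -{1}(conjg1 s) cox_length_refl //.
Qed.

Lemma exchange w u s : s \in S -> word_for S w u -> (l (s * w)%g < l w)%N ->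
  exists u1 x u2, u = u1 ++ x :: u2 /\ (\prod_(y <- u1 ++ u2) y = s * w)%g.
Proof.
move=> sS uw lt; have [n [nM n_gen]] := reflection_cocycle.
apply: (cocycle_delete nM n_gen uw); apply: contraLR lt => /=.
by rewrite -{1}(conjg1 s) -leqNgt => /(cocycle_gt nM n_gen sS)/ltnW; rewrite conjg1.
Qed.

Lemma reduced_exprE w u :
  reduced_expr S w u <-> word_for S w u /\ size u = l w.
Proof.
split=> [ru|[uw su]]; first by split; [exact: ru.1 | exact: reduced_size].
by apply: reduced_exprP; rewrite ?su.
Qed.

Lemma reduced_expr_cat w u v : reduced_expr S w (u ++ v) ->
  reduced_expr S (\prod_(x <- u) x)%g u /\ reduced_expr S (\prod_(x <- v) x)%g v.
Proof.
case/reduced_exprE=> -[]; rewrite all_cat big_cat size_cat => /andP[uS vS] <- suv.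
have uw : word_for S (\prod_(x <- u) x)%g u by [].
have vw : word_for S (\prod_(x <- v) x)%g v by [].
have := cox_lengthM (\prod_(x <- u) x) (\prod_(x <- v) x)%g.
rewrite -suv => le; split; apply: reduced_exprP => //.
  by rewrite -(leq_add2r (size v)) (leq_trans le) // leq_add2l cox_length_le.
by rewrite -(leq_add2l (size u)) (leq_trans le) // leq_add2r cox_length_le.
Qed.

(** A word in [J] is made reduced letter by letter: when a new letter lowers the length, exchange
    deletes a letter of the word, which stays in [J]. *)
Lemma parabolic_reduced (J : {set W}) w : J \subset S -> w \in <<J>>%g ->
  exists2 u, all [in J] u & reduced_expr S w u.
Proof.
move=> sJS /(gen_word sJS)[u uJ <-] {w}; elim: u uJ => [|s u IHu] /=.
  by exists [::]; rewrite // big_nil; split=> //; split; rewrite ?big_nil.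
case/andP=> sJ /IHu[v vJ [vw v_min]]; rewrite big_cons.
have sS := fintype.subsetP sJS _ sJ; set w := (\prod_(x <- u) x)%g in vw v_min *.
have sv : size v = l w by apply: reduced_size.
have [lt|ge] := ltnP (l w) (l (s * w)%g).
  exists (s :: v); first by rewrite /= sJ.
  apply: reduced_exprP; last by rewrite /= sv.
  exact: (word_for_cat (word_for1 sS) vw).
have lt : (l (s * w)%g < l w)%N by rewrite cox_length_ltnNge // -leqNgt.
have [v1 [x [v2 [ev e]]]] := exchange sS vw lt.
move: vJ vw.1; rewrite ev !all_cat /= => /and3P[v1J _ v2J] /and3P[v1S _ v2S].
exists (v1 ++ v2); first by rewrite all_cat v1J.
apply: reduced_exprP; first by split=> //; rewrite all_cat v1S.
have {e} -> : l (s * w)%g = (l w).-1.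
  have := cox_lengthMl (w := s * w) sS; rewrite gen_mulK // => -> //.
by rewrite -sv ev !size_cat /= addnS.
Qed.

Lemma longestP (I : {set W}) :
  longest S I \in <<I>>%g /\ {in <<I>>%g, forall w, (l w <= l (longest S I))%N}.
Proof. by rewrite /longest; case: arg_maxnP => //; apply: group1. Qed.

(** By maximality the cocycle of [x] counts every conjugate in [<<I>>] of an element of [I], so each
    letter of a reduced word of [w] shortens the product by one. *)
Lemma maximal_length_sub (I : {set W}) x : I \subset S -> x \in <<I>>%g ->
  {in <<I>>%g, forall w, (l w <= l x)%N} ->
  {in <<I>>%g, forall w, (l (w * x)%g + l w)%N = l x}.
Proof.
move=> sIS xI x_max w /(parabolic_reduced sIS)[u uI ru].
rewrite -(reduced_size ru); move: ru.1.2 (ru) => <- {}ru.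
elim: u uI ru => [|s u IHu]; first by rewrite big_nil mul1g addn0.
rewrite big_cons => /andP[/= sI uI] ru; have sS := fintype.subsetP sIS _ sI.
have [_ ru'] := @reduced_expr_cat _ [:: s] u ru; have {IHu} := IHu uI ru'.
set w' := (\prod_(y <- u) y)%g in ru ru' *; have [n [nM n_gen]] := reflection_cocycle.
have nx : n x (s ^ w')%g.
  have : ~~ (l x < l (s ^ w' * x)%g)%N.
    rewrite -leqNgt; apply/x_max/groupM => //; apply: groupJ; first exact: mem_gen.
    exact: word_in_gen.
  by apply: contraR; apply: cocycle_gt.
(* The reflection [s ^ w'] is counted for [x] but not for [w'^-1], since [s * w'] is longer than
   [w']; hence [s] is counted for [w' * x]. *)
have nw : n w'^-1%g (s ^ w')%g = false.
  apply/negbTE/negP => /(cocycle_lt nM n_gen).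
  rewrite conjgE -!mulgA mulgV mulg1 -{1}(gen_inv sS) -invMg !cox_lengthV.
  by rewrite -(reduced_size ru) -(reduced_size ru') ltnNge leqnSn.
move: nx; rewrite -[in X in n X](mulKg w' x) nM nw conjgK => /(cocycle_lt nM n_gen) lt.
have := cox_lengthMl (w := (s * (w' * x))%g) sS.
by rewrite gen_mulK // => /(_ lt)->; rewrite addSnnS mulgA.
Qed.

(** Both elements have the same length, and [maximal_length_sub] then gives [y^-1 * x] length
    [0]. *)
Lemma maximal_length_uniq (I : {set W}) x y : I \subset S ->
  x \in <<I>>%g -> {in <<I>>%g, forall w, (l w <= l x)%N} ->
  y \in <<I>>%g -> {in <<I>>%g, forall w, (l w <= l y)%N} -> x = y.
Proof.
move=> sIS xI x_max yI y_max.
have lxy : l x = l y by apply/eqP; rewrite eqn_leq x_max // y_max.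
have := maximal_length_sub sIS xI x_max (groupVr yI).
rewrite cox_lengthV lxy -[RHS]add0n => /addIn/eqP.
by rewrite cox_length_eq0 => /eqP e; apply: (mulgI y^-1%g); rewrite e mulVg.
Qed.

Lemma longest_descent (I : {set W}) s : I \subset S -> s \in I ->
  (l (s * longest S I)%g < l (longest S I))%N.
Proof.
move=> sIS sI; have sS := fintype.subsetP sIS _ sI; have [wI w_max] := longestP I.
rewrite cox_length_ltnNge // -leqNgt; apply/w_max/groupM => //; exact: mem_gen.
Qed.

Lemma longestV (I : {set W}) : I \subset S -> (longest S I)^-1%g = longest S I.
Proof.
move=> sIS; have [wI w_max] := longestP I.
apply: (maximal_length_uniq sIS) => //; first by rewrite groupV.
by move=> w /w_max; rewrite cox_lengthV.
Qed.

(** * The diagram automorphism given by conjugation with the longest element *)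

Section Sigma.
Local Notation sg := (sigma S).

Lemma sigmaE w : sg w = (w ^ longest S S)%g.
Proof. by rewrite /sigma conjgE longestV // mulgA. Qed.

Lemma sigmaK : involutive sg.
Proof.
by move=> w; rewrite !sigmaE -conjgM -{1}(longestV (subxx S)) mulVg conjg1.
Qed.

(** Multiplication by [w_0] on either side complements lengths, so [w_0 s w_0] has the length of
    [s], at most [1]. *)
Lemma sigma_gen s : s \in S -> sg s \in S.
Proof.
move=> sS; have [_ w_max] := longestP S.
have inS w : w \in <<S>>%g by rewrite (cox_gen HW) inE.
have lwM w : (l (w * longest S S)%g + l w)%N = l (longest S S).
  exact: (maximal_length_sub (subxx S)).
have lMw w : (l (longest S S * w)%g + l w)%N = l (longest S S).
  by rewrite -cox_lengthV invMg longestV // -(cox_lengthV w) lwM.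
have := lMw (s * longest S S)%g; rewrite mulgA -[X in _ = X](lwM s) addnC => /addnI ls.
have [[uS uw] _] := reduced_wordP (sg s).
have : (size (reduced_word S (sg s)) <= 1)%N by rewrite -/(l (sg s)) ls cox_length_gen.
case: reduced_word uS uw => [|x [|//]] /=; last by rewrite big_seq1 andbT => xS <-.
(* An empty word means [sg s = 1], and then [s = sg 1 = 1 = sg s]. *)
rewrite big_nil => _ s1 _; suff -> : sg s = s by [].
by rewrite -[RHS]sigmaK -s1 !sigmaE !conj1g.
Qed.

Lemma sigmaM : {morph sg : v w / (v * w)%g}.
Proof. by move=> v w; rewrite !sigmaE conjMg. Qed.

Lemma sigma_word w u : word_for S w u -> word_for S (sg w) (map sg u).
Proof.
case=> uS <-; split; first by rewrite all_map; apply: sub_all uS => s; apply: sigma_gen.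
rewrite big_map; elim: u {uS} => [|s u IHu]; first by rewrite !big_nil sigmaE conj1g.
by rewrite !big_cons IHu sigmaM.
Qed.

Lemma sigma_length w : l (sg w) = l w.
Proof.
suff le v : (l (sg v) <= l v)%N by apply/eqP; rewrite eqn_leq le -{1}[w]sigmaK le.
by rewrite (leq_trans (cox_length_le (sigma_word (reduced_wordP v).1))) // size_map.
Qed.

Lemma sigma_reduced w u : reduced_expr S w u -> reduced_expr S (sg w) (map sg u).
Proof.
case/reduced_exprE=> uw su; apply/reduced_exprE.
by split; [exact: sigma_word | rewrite size_map sigma_length].
Qed.

Lemma sigma_imset_sub (I : {set W}) : I \subset S -> sg @: I \subset S.
Proof.
move=> sIS; apply/fintype.subsetP => _ /imsetP[s sI ->].
exact/sigma_gen/(fintype.subsetP sIS).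
Qed.

(** Since [sigma] preserves lengths and carries [<<I>>] onto [<<sg @: I>>], uniqueness of the
    element of maximal length applies. *)
Lemma longest_sigma (I : {set W}) : I \subset S ->
  longest S (sg @: I) = sg (longest S I).
Proof.
move=> sIS; have sgI : <<sg @: I>>%g = (<<I>> :^ longest S S)%g.
  by rewrite -genJ; congr <<_>>%g; apply/eq_imset => s; exact: sigmaE.
have mem_sg w : w \in <<I>>%g -> sg w \in <<sg @: I>>%g.
  by rewrite sgI sigmaE memJ_conjg.
have [wI w_max] := longestP I; have [vI v_max] := longestP (sg @: I).
apply: (maximal_length_uniq (sigma_imset_sub sIS)) => //; first exact: mem_sg.
move=> w; rewrite sigma_length sgI -[w]sigmaK {1}sigmaE memJ_conjg => /w_max.
by rewrite (sigma_length (sg w)).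
Qed.

Lemma sigma_setD (I : {set W}) : I \subset S ->
  S :\: sg @: I = sg @: (S :\: I).
Proof.
move=> sIS; apply/setP => s; rewrite -[s]sigmaK (mem_imset _ _ (inv_inj sigmaK)).
rewrite !inE (mem_imset _ _ (inv_inj sigmaK)); congr (_ && _).
by apply/idP/idP => /sigma_gen; rewrite ?sigmaK.
Qed.

End Sigma.

(** * Matsumoto's theorem *)

Section Matsumoto.
Variables (A : pzRingType) (a : W -> A).
Hypothesis braid : {in S &, forall s t, s != t ->
  \prod_(x <- altw s t (m s t)) a x = \prod_(x <- altw t s (m s t)) a x}.

Local Notation F u := (\prod_(x <- u) a x).

Lemma size_altw (s t : W) n : size (altw s t n) = n.
Proof. by elim: n s t => //= n IHn s t; rewrite IHn. Qed.

Lemma altw_cat (s t : W) i j : exists x y, altw s t (i + j) = altw s t i ++ altw x y j.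
Proof.
elim: i s t => [|i IHi] s t; first by exists s, t.
by have [x [y e]] := IHi t s; exists x, y; rewrite addSn /= e.
Qed.

(** Two equal alternating words give [(s t)^q = 1], so [m s t] divides [q] by [cox_order];
    reducedness excludes [q > m s t], and [q = m s t] is the braid relation. *)
Lemma matsumoto_alt s t w q : s \in S -> t \in S -> (0 < q)%N ->
  reduced_expr S w (altw s t q) -> reduced_expr S w (altw t s q) ->
  F (altw s t q) = F (altw t s q).
Proof.
move=> sS tS q0 rs rt; have [->//|nst] := eqVneq s t.
have altP := altw_prodP (f := id) (gen_mulV sS) (gen_mulV tS).
have mq : (m s t %| q)%N.
  apply: (cox_order HW sS tS nst); apply/altP.
  by rewrite rs.1.2 rt.1.2.
have m0 : (0 < m s t)%N by rewrite lt0n; apply: contraTneq mq => ->; rewrite dvd0n -lt0n.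
have [qm|mq'] := leqP q (m s t).
  by have -> : q = m s t; [apply/eqP; rewrite eqn_leq qm dvdn_leq | apply: braid].
have e : (\prod_(x <- altw s t (m s t)) x = \prod_(x <- altw t s (m s t)) x)%g.
  exact: (cox_rel HW).2.
(* The prefix with [m s t + 1] letters would be reduced, but a braid move on its tail makes it start
   with [t t], which cancels. *)
have [x [y eq]] := altw_cat t s (m s t).+1 (q - (m s t).+1).
rewrite subnKC // in eq; move: rt; rewrite eq => /reduced_expr_cat[] /reduced_size.
rewrite size_altw /= big_cons e; case: (m s t) m0 => //= k _.
rewrite big_cons gen_mulK // => le.
have : (l (\prod_(x <- altw s t k) x)%g <= size (altw s t k))%N.
  apply: cox_length_le; split=> //.
  by elim: k s t sS tS {nst altP mq mq' e eq le rs} => //= k IHk s t sS tS; rewrite sS IHk.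
by rewrite -le size_altw ltnNge leqnSn.
Qed.

(* Exchanging the first letter of one word into the other ([step]) turns a
   counterexample into one whose two words start with ever longer alternating
   words in two letters, and finally are alternating. *)
Lemma matsumoto w u v : reduced_expr S w u -> reduced_expr S w v -> F u = F v.
Proof.
have [k] := ubnP (l w); elim: k => // k IHk in w u v *; rewrite ltnS => lwk.
(* A common first or last letter can be cancelled, and the induction on length applies. *)
have head y u1 v1 : reduced_expr S w (y :: u1) -> reduced_expr S w (y :: v1) ->
    F (y :: u1) = F (y :: v1).
  move=> ru rv; rewrite !big_cons; congr (_ * _).
  have [_ ru1] := @reduced_expr_cat w [:: y] u1 ru.
  have [_ rv1] := @reduced_expr_cat w [:: y] v1 rv.
  apply: IHk (ru1) _; last first.
    suff -> : (\prod_(x <- u1) x = \prod_(x <- v1) x)%g by [].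
    by have := ru.1.2; rewrite -rv.1.2 !big_cons => /mulgI.
  by rewrite -(reduced_size ru1) (leq_trans _ lwk) // -(reduced_size ru).
have last z u1 v1 : reduced_expr S w (rcons u1 z) -> reduced_expr S w (rcons v1 z) ->
    F (rcons u1 z) = F (rcons v1 z).
  rewrite -!cats1 => ru rv; rewrite !big_cat; congr (_ * _).
  have [ru1 _] := reduced_expr_cat ru; have [rv1 _] := reduced_expr_cat rv.
  apply: IHk (ru1) _; last first.
    suff -> : (\prod_(x <- u1) x = \prod_(x <- v1) x)%g by [].
    by have := ru.1.2; rewrite -rv.1.2 !big_cat !big_seq1 => /mulIg.
  rewrite -(reduced_size ru1) (leq_trans _ lwk) // -(reduced_size ru).
  by rewrite size_cat addn1.
have step y z u1 v1 : reduced_expr S w (rcons u1 z) -> reduced_expr S w (y :: v1) ->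
    F (rcons u1 z) != F (y :: v1) ->
    reduced_expr S w (y :: u1) /\ F (y :: u1) = F (y :: v1).
  move=> ru rv nF; have := rv.1.1 => /= /andP[yS _].
  have [|p1 [x [p2 [e ep]]]] := exchange yS ru.1.
    rewrite -(reduced_size rv) /= ltnS -{1}rv.1.2 big_cons gen_mulK //.
    by have [_ /reduced_size<-] := @reduced_expr_cat w [:: y] v1 rv.
  have rp : reduced_expr S w (y :: p1 ++ p2).
    apply: reduced_exprP.
      split; last by rewrite big_cons ep gen_mulK.
      have := ru.1.1; rewrite e /= yS !all_cat /= => /and3P[-> _ ->].
      by [].
    by rewrite -(reduced_size ru) e /= !size_cat addnS.
  (* The deleted letter is the last one: otherwise the new word ends like [rcons u1 z] and starts
     like [y :: v1], and [last] and [head] would equate the two products. *)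
  case/lastP: p2 e rp {ep} => [|p2 z'].
    rewrite cats1 cats0 => /rcons_inj[-> _] rp.
    by split=> //; apply: head.
  rewrite -rcons_cons -rcons_cat => /rcons_inj[_ <-].
  rewrite -rcons_cat -rcons_cons => rp; case/negP: nF; apply/eqP.
  rewrite (last _ _ _ ru rp); exact: head.
move=> ru rv; apply/eqP/negP => /negP nF.
have [l0|l_gt0] := posnP (l w).
  have u0 : u = [::] by apply: size0nil; rewrite (reduced_size ru).
  have v0 : v = [::] by apply: size0nil; rewrite (reduced_size rv).
  by rewrite u0 v0 eqxx in nF.
have alt i : (i < l w)%N -> exists x y u1 v1,
    [/\ reduced_expr S w (altw x y i.+1 ++ u1), reduced_expr S w (altw y x i.+1 ++ v1)
      & F (altw x y i.+1 ++ u1) != F (altw y x i.+1 ++ v1)].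
  elim: i => [_|i IHi lti].
    move: l_gt0 (ru) rv nF; rewrite -{1}(reduced_size ru).
    case: u {ru} => [|x u1] // _ ru rv.
    have : (0 < size v)%N by rewrite (reduced_size rv) // -(reduced_size ru).
    by case: v rv => [|y v1] // rv _ nF; exists x, y, u1, v1.
  have [x [y [u1 [v1 [ru1 rv1 nF1]]]]] := IHi (ltnW lti).
  have := reduced_size ru1; have := reduced_size rv1.
  rewrite !size_cat !size_altw.
  case/lastP: v1 rv1 nF1 => [|v1 z'] rv1 nF1; first by move=> e; rewrite -e addn0 ltnn in lti.
  case/lastP: u1 ru1 nF1 => [|u1 z] ru1 nF1; first by move=> _ e; rewrite -e addn0 ltnn in lti.
  rewrite -!rcons_cat in ru1 rv1 nF1; move=> _ _.
  have [ru2 eF] := step y z (altw x y i.+1 ++ u1) (rcons (altw x y i ++ v1) z') ru1 rv1 nF1.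
  rewrite eq_sym in nF1.
  have [rv2 eF'] := step x z' (altw y x i.+1 ++ v1) (rcons (altw y x i ++ u1) z) rv1 ru1 nF1.
  exists x, y, v1, u1; split=> //.
  rewrite [F (altw x y _ ++ _)]eF' [F (altw y x _ ++ _)]eF eq_sym. exact: nF1.
(* At this index the alternating prefixes have [l w] letters and exhaust both words. *)
have [|x [y [u1 [v1 [ru1 rv1 nF1]]]]] := alt (l w).-1; first by rewrite prednK.
rewrite prednK // in ru1 rv1 nF1.
have := reduced_size ru1; have := reduced_size rv1.
rewrite !size_cat !size_altw => /eqP; rewrite -[X in _ == X]addn0 eqn_add2l => /nilP v0.
move=> /eqP; rewrite -[X in _ == X]addn0 eqn_add2l => /nilP u0.
rewrite u0 v0 !cats0 in ru1 rv1 nF1.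
case/negP: nF1; apply/eqP; apply: matsumoto_alt (ru1) (rv1) => //.
  by move: ru1.1.1; rewrite -(prednK l_gt0) => /andP[].
by move: rv1.1.1; rewrite -(prednK l_gt0) => /andP[].
Qed.

End Matsumoto.

(** * Products along reduced words in the 0-Hecke algebra *)

Section HeckeProducts.
Variables (F : fieldType) (A : algType F) (a : W -> A).
Hypothesis Ha : zero_hecke_relations S m a.

Local Notation T w := (\prod_(x <- reduced_word S w) a x).

Lemma hecke_reduced w u : reduced_expr S w u -> \prod_(x <- u) a x = T w.
Proof. by move=> ru; apply: (matsumoto Ha.2 ru); apply: reduced_wordP. Qed.

Lemma hecke1 : T 1%g = 1.
Proof.
rewrite -(@hecke_reduced 1%g [::]) ?big_nil //; apply: reduced_exprP => //.
by split; rewrite ?big_nil.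
Qed.

Lemma hecke_mull_gt w s : s \in S -> (l w < l (s * w)%g)%N -> a s * T w = T (s * w)%g.
Proof.
move=> sS lt; have [rw _] := reduced_wordP w.
rewrite -(@hecke_reduced (s * w)%g (s :: reduced_word S w)) ?big_cons //.
by apply: reduced_exprP; [exact: (word_for_cat (word_for1 sS) rw) | exact: lt].
Qed.

Lemma hecke_mull_lt w s : s \in S -> (l (s * w)%g < l w)%N -> a s * T w = T w.
Proof.
move=> sS lt; have := hecke_mull_gt (w := s * w) sS; rewrite gen_mulK //.
by move=> /(_ lt)<-; rewrite mulrA Ha.1.
Qed.

Lemma hecke_mulr_gt w s : s \in S -> (l w < l (w * s)%g)%N -> T w * a s = T (w * s)%g.
Proof.
move=> sS lt; have [rw _] := reduced_wordP w.
rewrite -(@hecke_reduced (w * s)%g (reduced_word S w ++ [:: s])).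
  by rewrite big_cat big_seq1.
apply: reduced_exprP; first exact: (word_for_cat rw (word_for1 sS)).
by rewrite size_cat addn1.
Qed.

Lemma hecke_mulr_lt w s : s \in S -> (l (w * s)%g < l w)%N -> T w * a s = T w.
Proof.
move=> sS lt; have := hecke_mulr_gt (w := w * s) sS; rewrite -mulgA gen_mulV // mulg1.
by move=> /(_ lt)<-; rewrite -mulrA Ha.1.
Qed.

Lemma cox_lengthMr_ltnNge w s : s \in S -> (l (w * s)%g < l w)%N = ~~ (l w < l (w * s)%g)%N.
Proof.
move=> sS; rewrite -(cox_lengthV (w * s)) invMg gen_inv // -(cox_lengthV w).
exact: cox_length_ltnNge.
Qed.

(** Each letter either lengthens the index or is absorbed. *)
Lemma hecke_mulr_word w u : all [in S] u ->
  exists2 x, T w * \prod_(y <- u) a y = T x & (l w <= l x)%N.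
Proof.
elim: u w => [|s u IHu] w /=; first by exists w; rewrite // big_nil mulr1.
case/andP=> sS uS; rewrite big_cons mulrA.
have [lt|ge] := ltnP (l w) (l (w * s)%g).
  rewrite hecke_mulr_gt //; have [x e le] := IHu (w * s)%g uS.
  by exists x; rewrite // (leq_trans _ le) // ltnW.
by rewrite hecke_mulr_lt ?cox_lengthMr_ltnNge // -?leqNgt //; apply: IHu.
Qed.

Lemma hecke_longest_mull (I : {set W}) s : I \subset S -> s \in I ->
  a s * T (longest S I) = T (longest S I).
Proof.
move=> sIS sI; apply: hecke_mull_lt; first exact: (fintype.subsetP sIS).
exact: longest_descent.
Qed.

Lemma hecke_longest_mulr (I : {set W}) s : I \subset S -> s \in I ->
  T (longest S I) * a s = T (longest S I).
Proof.
move=> sIS sI; have sS := fintype.subsetP sIS _ sI; apply: hecke_mulr_lt => //.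
rewrite -cox_lengthV invMg gen_inv // longestV //.
exact: longest_descent.
Qed.

Lemma hecke_longest_word (I : {set W}) : I \subset S ->
  exists2 u, all [in I] u & T (longest S I) = \prod_(x <- u) a x.
Proof.
move=> sIS; have [wI _] := longestP I; have [u uI ru] := parabolic_reduced sIS wI.
by exists u; rewrite // (hecke_reduced ru).
Qed.

Lemma hecke_longest_idem (I : {set W}) : I \subset S ->
  T (longest S I) * T (longest S I) = T (longest S I).
Proof.
move=> sIS; have [u uI {2}->] := hecke_longest_word sIS.
elim: u uI => [|s u IHu] /=; first by rewrite big_nil mulr1.
by case/andP=> sI uI; rewrite big_cons mulrA hecke_longest_mulr // IHu.
Qed.

End HeckeProducts.

(** * Unitriangularity for the length filtration *)

Section Nilpotence.
Variables (F : fieldType) (A : algType F) (a b : W -> A).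
Hypotheses (Ha : zero_hecke_relations S m a) (Hb : zero_hecke_relations S m b).
Hypothesis ab : {in S, forall s, b s = 1 - a s}.
Variables I J : {set W}.
Hypotheses (sIS : I \subset S) (sJS : J \subset S).

Local Notation T w := (\prod_(x <- reduced_word S w) a x).
Local Notation alpha := (T (longest S I)).
Local Notation beta := (\prod_(x <- reduced_word S (longest S J)) b x).

(** The claim [z0] says that each factor [alpha * beta - 1] gains one step in the length filtration,
    which ends at the longest element; [w = 1] gives the result. *)
Lemma hecke_unipotent :
  exists n, alpha * beta * (alpha * beta - 1) ^+ n = 0.
Proof.
pose z n := alpha * beta * (alpha * beta - 1) ^+ n.
suff z0 n w : (l (longest S S) < l w + n)%N -> T w * z n = 0.
  exists (l (longest S S)).+1; rewrite -/(z _) -[z _]mul1r -(hecke1 Ha).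
  by apply: z0; rewrite cox_length1.
elim: n w => [|n IHn] w.
  have [_ w_max] := longestP S; rewrite addn0 ltnNge w_max // (cox_gen HW) inE //.
rewrite addnS ltnS => lw.
have [u uI eu] := hecke_longest_word Ha sIS.
have uS : all [in S] u by apply: sub_all uI => s; apply: (fintype.subsetP sIS).
have [x ex le_wx] := hecke_mulr_word Ha w uS; rewrite -eu in ex.
have xalpha : T x * alpha = T x by rewrite -ex -mulrA hecke_longest_idem.
(* From [alpha * beta * (alpha * beta - 1) = alpha * (beta * alpha - 1) * beta] and
   [T x * alpha = T x], the goal becomes [T x * beta * z n = T x * z n]. *)
have zS : T w * z n.+1 = T x * (beta * alpha - 1) * (beta * (alpha * beta - 1) ^+ n).
  rewrite /z exprS !mulrA ex; congr (_ * _).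
  by rewrite mulrBr mulrBr mulrBl !mulr1 !mulrA.
have zx : T x * z n = T x * (beta * (alpha * beta - 1) ^+ n).
  by rewrite /z !mulrA xalpha.
rewrite zS mulrBr mulr1 mulrBl -zx -mulrA.
have -> : beta * alpha * (beta * (alpha * beta - 1) ^+ n) = beta * z n.
  by rewrite /z !mulrA.
have z_gt v : (l x < l v)%N -> T v * z n = 0.
  by move=> lt; apply: IHn; rewrite (leq_ltn_trans lw) // ltn_add2r (leq_ltn_trans le_wx).
(* With a right descent [s] in [J], [T x] absorbs [a s] while [a s * beta = 0], so both sides
   vanish. *)
have [/exists_inP[s sJ lt]|/exists_inPn desc] := boolP [exists s in J, l (x * s)%g < l x]%N.
  have sS := fintype.subsetP sJS _ sJ.
  have sbeta : a s * beta = 0.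
    by rewrite -(hecke_longest_mull Hb sJS sJ) ab // mulrA mulrBr mulr1 Ha.1 // subrr mul0r.
  have xbeta : T x * beta = 0.
    by rewrite -(hecke_mulr_lt Ha sS lt) -mulrA sbeta mulr0.
  by rewrite zx !mulrA xbeta !mul0r subrr.
(* Without such a descent, expanding the factors [1 - a t] of [beta] turns [T x * beta] into [T x]
   plus signed terms [T y] with [y] longer than [x], which the induction hypothesis kills against
   [z n]. *)
have [v vJ ->] := hecke_longest_word Hb sJS.
pose P v := \prod_(t <- v) b t * z n; rewrite -/(P v).
have P_cons y s u' : s \in S -> T y * P (s :: u') = T y * P u' - T y * a s * P u'.
  by move=> sS; rewrite /P big_cons ab // mulrBl mul1r mulrBl mulrBr !mulrA.
have P_nil y : T y * P [::] = T y * z n by rewrite /P big_nil mul1r.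
have longer v' y : all [in S] v' -> (l x < l y)%N -> T y * P v' = 0.
  elim: v' y => [|s v' IHv] y /=; first by move=> _ /z_gt; rewrite P_nil.
  case/andP=> sS v'S lt; rewrite P_cons // IHv // sub0r.
  have [lts|ge] := ltnP (l y) (l (y * s)%g).
    by rewrite hecke_mulr_gt // IHv ?oppr0 // (ltn_trans lt).
  by rewrite hecke_mulr_lt ?cox_lengthMr_ltnNge // -?leqNgt // IHv ?oppr0.
suff -> : T x * P v = T x * z n by rewrite subrr.
elim: v vJ => [|s v IHv] /=; first by rewrite P_nil.
case/andP=> sJ vJ; have sS := fintype.subsetP sJS _ sJ.
have lt : (l x < l (x * s)%g)%N.
  by have := desc s sJ; rewrite cox_lengthMr_ltnNge // negbK.
rewrite P_cons // IHv // hecke_mulr_gt // longer ?subr0 //.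
by apply: sub_all vJ => t; apply: (fintype.subsetP sJS).
Qed.

End Nilpotence.

End CoxeterGroup.

(** * Left ideals and their isomorphisms *)

Section ModuleIsomorphisms.

Lemma mod_iso_of_linear (R : nzRingType) (M N : lmodType R) (f : M -> N) :
  linear f -> injective f -> (forall y, exists x, f x = y) -> mod_iso M N.
Proof.
move=> f_lin f_inj f_surj.
pose f' : {linear M -> N} := HB.pack f (GRing.isLinear.Build R M N _ f f_lin).
exists f'; pose g y := sval (cid (f_surj y)).
have gK : cancel g f by move=> y; rewrite /g; case: cid.
by exists g => // x; apply: f_inj; rewrite gK.
Qed.

Lemma mod_iso_trans (R : nzRingType) (M N P : lmodType R) :
  mod_iso M N -> mod_iso N P -> mod_iso M P.
Proof. by move=> [f f_bij] [g g_bij]; exists (g \o f); apply: bij_comp. Qed.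

Lemma mod_iso_eqi (R : nzRingType) (J K : leftIdeal R) :
  J =i K -> mod_iso (ideal_module J) (ideal_module K).
Proof.
move=> JK; have JP (x : ideal_module J) : ideal_val x \in K by rewrite -JK ideal_valP.
apply: (@mod_iso_of_linear _ _ _ (fun x => IdealModule (JP x))).
- by move=> a x y; apply: val_inj.
- by move=> x y /(congr1 val) /= e; apply: val_inj.
move=> y; have yJ : ideal_val y \in J by rewrite JK ideal_valP.
by exists (IdealModule yJ); apply: val_inj.
Qed.

Lemma principal_idealP (R : nzRingType) (g x : R) :
  reflect (exists h, x = h * g) (x \in principal_ideal g).
Proof. exact: asboolP. Qed.

(** The isomorphism is right multiplication by [a]; the first nilpotence hypothesis gives
    injectivity, the second surjectivity. *)
Lemma mod_iso_principal (R : nzRingType) (a b : R) (j k : nat) :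
  a * b * (a * b - 1) ^+ j = 0 -> b * a * (b * a - 1) ^+ k = 0 ->
  mod_iso (ideal_module (principal_ideal (a * b)))
          (ideal_module (principal_ideal (b * a))).
Proof.
move=> ab_nil ba_nil.
have mulP (x : ideal_module (principal_ideal (a * b))) :
    (ideal_val x : R) * a \in principal_ideal (b * a).
  have /principal_idealP[h ->] := ideal_valP x; apply/principal_idealP.
  by exists (h * a); rewrite !mulrA.
apply: (@mod_iso_of_linear _ _ _ (fun x => IdealModule (mulP x))).
- by move=> c x y; apply: val_inj; rewrite /= mulrDl; congr (_ + _); apply/esym/mulrA.
- move=> x y /(congr1 val) /= e; apply: val_inj => /=; apply/eqP; rewrite -subr_eq0.
  set z := (_ - _ : R); have za : z * a = 0 by rewrite mulrBl e subrr.
  have /principal_idealP[h zE] : z \in principal_ideal (a * b).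
    by rewrite rpredB ?ideal_valP.
  (* On an element killed by [a], the factor [a * b - 1] acts as [-1], yet its [j]-th power kills
     the ideal of [a * b]. *)
  have zX i : z * (a * b - 1) ^+ i = (-1) ^+ i * z.
    elim: i => [|i IHi]; first by rewrite mulr1 mul1r.
    by rewrite exprS mulrA mulrBr mulr1 mulrA za mul0r sub0r exprS mulN1r !mulNr IHi.
  have := zX j; rewrite {1}zE -mulrA ab_nil mulr0 => /(congr1 ( *%R ((-1) ^+ j))).
  by rewrite mulr0 mulrA -exprD addnn -signr_odd odd_double mul1r => <-.
move=> y; have /principal_idealP[h yE] := ideal_valP y.
(* [Q] is the truncated geometric series for an inverse of [a * b]: [b * Q * a] differs from [1] by
   [(1 - b * a) ^+ k], which [b * a] kills. As [Q] commutes with [a * b], the preimage built from it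
   lies in the ideal. *)
pose Q := \sum_(i < k) (1 - a * b) ^+ i.
have bQ : 1 - (1 - b * a) ^+ k = b * Q * a.
  rewrite -opprB subrX1 -mulNr opprB subKr /Q !mulr_sumr mulr_suml.
  apply: eq_bigr => i _; rewrite -!mulrA; congr (_ * _).
  elim: {i}(i : nat) => [|i IHi]; first by rewrite mulr1 mul1r.
  by rewrite !exprS -[RHS]mulrA -IHi !mulrA; congr (_ * _); rewrite mulrBr mulrBl mulr1 mul1r mulrA.
have abQ : a * b * Q = Q * (a * b).
  rewrite mulr_sumr mulr_suml; apply: eq_bigr => i _.
  by apply: commrX; rewrite /GRing.comm mulrBr mulrBl mulr1 mul1r.
have xP : h * b * a * b * Q \in principal_ideal (a * b).
  by apply/principal_idealP; exists (h * b * Q); rewrite -!mulrA -[Q * _]abQ !mulrA.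
exists (IdealModule xP); apply: val_inj; rewrite /= yE.
have -> : h * b * a * b * Q * a = h * (b * a) * (b * Q * a) by rewrite !mulrA.
have baN : b * a * (1 - b * a) ^+ k = 0.
  by rewrite -opprB exprNn mulrA commr_sign -mulrA ba_nil mulr0.
by rewrite -bQ -mulrA mulrBr mulr1 baN subr0.
Qed.

(** The map is [f] itself: [f (c * x) = f c * f x] is linearity for the twisted action. *)
Lemma mod_iso_twist (F : fieldType) (A : algType F) (f : algAut A)
    (J K : leftIdeal A) : image_ideal f J =i K ->
  mod_iso (ideal_module J) (twist f (ideal_module K)).
Proof.
move=> JK; have fP (x : ideal_module J) : f (ideal_val x : A) \in K.
  by rewrite -JK; apply/asboolP; exists (ideal_val x) => //; apply: ideal_valP.
pose g (x : ideal_module J) : twist f (ideal_module K) := IdealModule (fP x).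
have [f' fK f'K] := algAut_bij f.
apply: (@mod_iso_of_linear _ _ _ g).
- move=> c x y; apply: val_inj => /=; rewrite /twist_scale /=.
  by rewrite rmorphD /= (rmorphM f c (ideal_val x)).
- by move=> x y /(congr1 val) /= /(can_inj fK) e; apply: val_inj.
move=> y; have := ideal_valP (y : ideal_module K).
by rewrite -JK => /asboolP[x xJ e]; exists (IdealModule xJ); apply: val_inj.
Qed.

Lemma image_principal_ideal (F : fieldType) (A : algType F) (f : algAut A) (g : A) :
  image_ideal f (principal_ideal g) =i principal_ideal (f g).
Proof.
have [f' fK f'K] := algAut_bij f; move=> x; apply/idP/idP.
  move=> /asboolP[_ /principal_idealP[h ->] ->]; apply/principal_idealP.
  by exists (f h); rewrite rmorphM.
move=> /principal_idealP[h ->]; apply/asboolP; exists (f' h * g).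
  by apply/principal_idealP; exists (f' h).
by rewrite (rmorphM f) /= f'K.
Qed.

Lemma principal_ideal_sign (R : nzRingType) (g : R) n :
  principal_ideal ((-1) ^+ n * g) =i principal_ideal g.
Proof.
move=> x; apply/principal_idealP/principal_idealP=> -[h ->].
  by exists (h * (-1) ^+ n); rewrite mulrA.
by exists (h * (-1) ^+ n); rewrite mulrA -(mulrA h) -exprD addnn -signr_odd odd_double mulr1.
Qed.

End ModuleIsomorphisms.

Theorem proposition5p1 (F : fieldType) (W : finGroupType) (S : {set W})
    (m : W -> W -> nat) (HW : coxeter_system S m)
    (H : algType F) (pi : W -> H) (HH : zero_hecke_algebra S m pi)
    (theta phi : algAut H)
    (Htheta : {in S, forall s, theta (pi s) = 1 - pi s})
    (Hphi : {in S, forall s, phi (pi s) = pi (sigma S s)})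
    (I : {set W}) (HI : I \subset S) :
  let P := hecke_P S pi in
  [/\ mod_iso (ideal_module (image_ideal theta (P I)))
              (ideal_module (P (S :\: I))),
      mod_iso (ideal_module (P (S :\: I)))
              (twist theta (ideal_module (P I))),
      image_ideal phi (P I) =i P (sigma S @: I)%SET
    & mod_iso (ideal_module (P (sigma S @: I)%SET))
              (twist phi (ideal_module (P I)))].
Proof.
have Hpi := hecke_rel HH; pose b s := 1 - pi s.
have mapP (f : algAut H) u : f (\prod_(x <- u) pi x) = \prod_(x <- u) f (pi x).
  by rewrite rmorph_prod.
have reduced_sub w : {subset reduced_word S w <= S}.
  by move=> s; have [[/allP uS _] _] := reduced_wordP HW w; apply: uS.
(* On [S], [b] is the image of [pi] under [theta], which transports the relations. *)
have Hb : zero_hecke_relations S m b.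
  split=> [s sS|s t sS tS nst].
    by rewrite /b -Htheta // -rmorphM Hpi.1.
  have altS k x y : x \in S -> y \in S -> {in altw x y k, forall r, r \in S}.
    elim: k x y => [|k IHk] x y xS yS // r; rewrite inE => /predU1P[->//|].
    exact: IHk.
  have bE x y k : x \in S -> y \in S ->
      \prod_(r <- altw x y k) b r = theta (\prod_(r <- altw x y k) pi r).
    move=> xS yS; rewrite mapP !big_seq; apply: eq_bigr => r /altS rS.
    by rewrite Htheta // rS.
  by rewrite !bE // Hpi.2.
pose p w := \prod_(s <- reduced_word S w) pi s.
pose q w := \prod_(s <- reduced_word S w) b s.
have hpibarE w : hpibar S pi w = (-1) ^+ cox_length S w * q w.
  rewrite /hpibar /q /cox_length; elim: reduced_word => [|s u IHu].
    by rewrite !big_nil mulr1.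
  rewrite !big_cons IHu /= exprS -opprB -/(b s) mulN1r !mulNr; congr (- _).
  by rewrite !mulrA commr_sign.
have theta_p w : theta (p w) = q w.
  by rewrite mapP /q !big_seq; apply: eq_bigr => s /reduced_sub/Htheta.
have theta_q w : theta (q w) = p w.
  rewrite /q rmorph_prod /p !big_seq; apply: eq_bigr => s /reduced_sub sS.
  by rewrite /b rmorphB rmorph1 /= Htheta // subKr.
(* The image is the product along [sigma] of a reduced word of [w], a reduced word of [sigma w] that
   may differ from the chosen one; Matsumoto's theorem identifies the products. *)
have phi_p w : phi (p w) = p (sigma S w).
  rewrite mapP /p -(hecke_reduced HW Hpi (sigma_reduced HW (reduced_wordP HW w))).
  by rewrite big_map !big_seq; apply: eq_bigr => s /reduced_sub/Hphi.
have phi_q w : phi (q w) = q (sigma S w).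
  rewrite /q rmorph_prod -(hecke_reduced HW Hb (sigma_reduced HW (reduced_wordP HW w))).
  rewrite big_map !big_seq; apply: eq_bigr => s /reduced_sub sS.
  by rewrite /b rmorphB rmorph1 /= Hphi.
have PE (J : {set W}) :
    hecke_P S pi J =i principal_ideal (q (longest S J) * p (longest S (S :\: J))).
  by move=> x; rewrite /hecke_P hpibarE -mulrA principal_ideal_sign.
have image_PE (f : algAut H) (J : {set W}) : image_ideal f (hecke_P S pi J)
    =i principal_ideal (f (q (longest S J) * p (longest S (S :\: J)))).
  move=> x; rewrite -image_principal_ideal.
  by apply/asboolP/asboolP=> -[y]; rewrite ?PE => yP ->; exists y; rewrite ?PE.
have SDD : S :\: (S :\: I) = I.
  by rewrite finset.setDDr finset.setDv finset.set0U; apply/finset.setIidPr.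
have [j ab_nil] := hecke_unipotent HW Hpi Hb (fun s _ => erefl) HI (finset.subsetDl S I).
(* The other order of the factors: [pi] and [b] change places, and so do [I] and its complement. *)
have [|k ba_nil] := hecke_unipotent HW Hb Hpi _ (finset.subsetDl S I) HI.
  by move=> s _; rewrite /b subKr.
have thetaPE : image_ideal theta (hecke_P S pi I)
    =i principal_ideal (p (longest S I) * q (longest S (S :\: I))).
  by move=> x; rewrite image_PE rmorphM /= theta_q theta_p.
have theta_iso : mod_iso (ideal_module (image_ideal theta (hecke_P S pi I)))
                         (ideal_module (hecke_P S pi (S :\: I))).
  apply: mod_iso_trans (mod_iso_eqi thetaPE) _.
  apply: mod_iso_trans (mod_iso_principal ab_nil ba_nil) _.
  by apply: mod_iso_eqi => x; rewrite PE SDD.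
have phiPE (J : {set W}) : J \subset S ->
    image_ideal phi (hecke_P S pi J) =i hecke_P S pi (sigma S @: J)%SET.
  move=> JS x; rewrite image_PE rmorphM /= phi_q phi_p PE.
  by rewrite (sigma_setD HW) // !(longest_sigma HW) ?finset.subsetDl.
split=> //.
(* The intermediate ideal is [theta (P I)], which [theta] maps back onto [P I]. *)
- apply: mod_iso_trans (mod_iso_twist (J := principal_ideal (p (longest S I)
      * q (longest S (S :\: I)))) _).
    apply: mod_iso_trans (mod_iso_principal ba_nil ab_nil).
    by apply: mod_iso_eqi => x; rewrite PE SDD.
  by move=> x; rewrite image_principal_ideal rmorphM /= theta_p theta_q PE.
- exact: phiPE.
(* Here [phi] maps the ideal of [sigma I] onto that of [sigma (sigma I) = I]. *)
apply: mod_iso_twist => x; rewrite phiPE ?(sigma_imset_sub HW) //.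
suff -> : (sigma S @: (sigma S @: I) = I)%SET by [].
rewrite -imset_comp -[RHS]imset_id; apply: eq_imset => s; exact: (sigmaK HW).
Qed.
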